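(* Let $J\subset\mathbb{R}$ be an open interval containing $t_0$, let $N\ge 0$ be an integer, and for each $t\in J$ let $$\mathrm{d}\mu(\theta;t)=\sum_{j=0}^{N}\gamma_j(t)\,\delta(\theta-\omega_j(t))$$ be a finite nonnegative measure on the unit circle (parametrized by $z=e^{i\theta}$), where $\gamma_j,\omega_j:J\to\mathbb{R}$ are differentiable functions of $t$ and, for each $t$, the points $e^{i\omega_0(t)},\dots,e^{i\omega_N(t)}$ are distinct. Let $n$ be such that for every $t\in J$ the support of $\mathrm{d}\mu(\cdot;t)$ contains at least $n$ points, and let $P(\cdot;t)$ be a nonconstant monic paraorthogonal polynomial on the unit circle (POPUC) of degree $n$ associated with $\mathrm{d}\mu(\theta;t)$. Assume that $P(\zeta_0;t_0)=0$, and let $\epsilon,\delta>0$ and $\zeta:I_\epsilon(t_0)\to C_\delta(\zeta_0)$ be a differentiable function with $\zeta(t_0)=\zeta_0$ and $P(\zeta(t);t)=0$ for each $t\in I_\epsilon(t_0)$. Write $\zeta(t)=e^{i\varphi(t)}$. Suppose that $P(\overline{\zeta(t)};t)=0$ and $\varphi(t)\in(0,\pi)$ (arguments taken modulo $2\pi$ in $[-\pi,\pi)$) for each $t\in I_\epsilon(t_0)$. Denote the zeros of $P(\cdot;t)$ by $\zeta_k(t)=e^{i\varphi_k(t)}$ $(k=1,\dots,n)$, labelled so that $\varphi(t)=\varphi_n(t)=-\varphi_{n-1}(t)$. Define $$\widetilde{s}(\theta;t)=\frac12\,\frac{1}{\cos(\varphi(t))-\cos(\theta)},\qquad \widetilde{S}(\theta;t)=\frac{\sin(\theta)}{\cos(\theta)-\cos(\varphi(t))}+\sum_{k=1}^{n-2}\cot\left(\frac{\varphi_k(t)-\theta}{2}\right),$$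 and $$\widetilde{W}_j(t)=\widetilde{s}(\omega_j(t);t)\,\frac{\mathrm{d}\gamma_j}{\mathrm{d}t}(t)-\gamma_j(t)\,\widetilde{s}(\omega_j(t);t)\,\widetilde{S}(\omega_j(t);t)\,\frac{\mathrm{d}\omega_j}{\mathrm{d}t}(t)\qquad(j=0,\dots,N).$$ Suppose that $\omega_j(t)\ne\varphi_k(t)$ modulo $2\pi$ for all $j,k$ and all $t\in I_\epsilon(t_0)$. If, for each $t\in I_\epsilon(t_0)$, $\widetilde{W}_j(t)$ is nonnegative for all $j$ and nonzero for at least one value of $j$, then $\zeta(t)=e^{i\varphi(t)}$ moves strictly counterclockwise along $\mathbb{S}^1$ as $t$ increases on $I_\epsilon(t_0)$. Furthermore, if $\widetilde{W}_j(t)=0$ for all $t\in I_\epsilon(t_0)$ and all $j$, then $\zeta(t)$ does not move as $t$ increases on $I_\epsilon(t_0)$.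
   Context: Notation: $\mathbb{D}_r(c)$ is the open disk in $\mathbb{C}$ of radius $r>0$ centred at $c$; $\mathbb{S}^1$ is the unit circle; $C_r(c)=\mathbb{D}_r(c)\cap\mathbb{S}^1$; $I_r(c)=\mathbb{D}_r(c)\cap\mathbb{R}$ (for $I_\epsilon(t_0)$, $\epsilon$ is small enough that $I_\epsilon(t_0)\subset J$). $\delta(\theta-\omega)$ denotes the unit point mass at $e^{i\omega}$. Orthogonal polynomials: $Q_m(z;t)=z^m+\cdots$ denotes the monic orthogonal polynomial of degree $m$ on the unit circle with respect to $\mathrm{d}\mu(\cdot;t)$, i.e. $\int Q_m(e^{i\theta};t)\overline{Q_l(e^{i\theta};t)}\,\mathrm{d}\mu(\theta;t)=0$ for $l\ne m$ and $\int|Q_m(e^{i\theta};t)|^2\mathrm{d}\mu(\theta;t)\ne 0$. If the measure consists of $M$ distinct point masses, these exist for degrees $0,\dots,M-1$. POPUC: the monic paraorthogonal polynomial of degree $n$ associated with $\mathrm{d}\mu(\cdot;t)$ and paraorthogonality parameter $b(t)\in\mathbb{S}^1$ is $$P(z;t)=zQ_{n-1}(z;t)-\overline{b(t)}\,Q_{n-1}^*(z;t),\qquad Q_{n-1}^*(z;t)=z^{n-1}\overline{Q_{n-1}(1/\overline z;t)}.$$ All its zeros are simple and lie on $\mathbb{S}^1$. ''Moves strictly counterclockwise along $\mathbb{S}^1$ as $t$ increases'' means that the continuous argument $\varphi(t)$ of $\zeta(t)$ is strictly increasing in $t$; ''does not move'' means $\zeta(t)$ is constant. *)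

(* Defs.v *)
From HB Require Import structures.
From mathcomp Require Import all_boot all_order all_algebra.
From mathcomp Require Import all_classical all_reals all_analysis.
From mathcomp Require Import complex.

Set Implicit Arguments.
Unset Strict Implicit.
Unset Printing Implicit Defensive.

Import Order.TTheory GRing.Theory Num.Theory.
Import numFieldNormedType.Exports.

Local Open Scope classical_set_scope.
Local Open Scope complex_scope.
Local Open Scope ring_scope.

Section Circle.
Variable R : realType.

Definition cis (x : R) : R[i] := cos x +i* sin x.

Definition disk (r : R) (c : R[i]) : set R[i] := [set z | `|z - c| < r%:C].

Definition unit_circle : set R[i] := [set z | `|z| = 1].

Definition circle_arc (r : R) (c : R[i]) : set R[i] := disk r c `&` unit_circle.

Definition eq_mod_2pi (x y : R) : Prop :=
  exists m : int, x = y + m%:~R * (2 * pi).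

Definition cot (x : R) : R := cos x / sin x.

(* [R[i]] is not declared as a normed space over [R], so differentiability of
   a function of a real variable is taken componentwise. *)
Definition cderivable (f : R -> R[i]) (t : R) : Prop :=
  derivable (fun u => complex.Re (f u)) t 1 /\
  derivable (fun u => complex.Im (f u)) t 1.

Definition continuous_argument (I : set R) (f : R -> R[i]) (phi : R -> R) :=
  {within I, continuous phi} /\ forall t, I t -> f t = cis (phi t).

Definition moves_strictly_ccw (I : set R) (f : R -> R[i]) (phi : R -> R) :=
  continuous_argument I f phi /\
  forall s t, I s -> I t -> s < t -> phi s < phi t.

Definition does_not_move (I : set R) (f : R -> R[i]) : Prop :=
  forall s t, I s -> I t -> f s = f t.

End Circle.

(* A measure on the unit circle is given as a measure in the parameter theta,
   the point z of the circle being z = cis theta.  Since theta ranges over the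
   whole real line, support and orthogonality are defined so as to
   depend on the measure only through its image by cis. *)
Section CircleMeasure.
Variable R : realType.
Local Notation measureR := {measure set (measurableTypeR R) -> \bar R}.

Definition point_masses (N : nat) (gamma omega : 'I_N.+1 -> R)
    (A : set (measurableTypeR R)) : \bar R :=
  (\sum_(j < N.+1) (gamma j)%:E * \d_(omega j : measurableTypeR R) A)%E.

Definition circle_support (mu : measureR) : set R[i] :=
  [set z | unit_circle z /\
     forall r : R, 0 < r -> (0 < mu (@cis R @^-1` disk r z))%E].

Definition cintegral (mu : measureR) (f : R -> R[i]) : R[i] :=
  (\int[mu]_x complex.Re (f x)) +i* (\int[mu]_x complex.Im (f x)).

Definition orthogonal_polys (mu : measureR) (n : nat)
    (Q : nat -> {poly R[i]}) : Prop :=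
  forall m, (m < n)%N ->
    [/\ Q m \is monic, size (Q m) = m.+1,
        forall l, (l < n)%N -> l <> m ->
          cintegral mu (fun x => (Q m).[cis x] * conjc (Q l).[cis x]) = 0
      & cintegral mu (fun x => `|(Q m).[cis x]| ^+ 2) <> 0].

Definition reversed_poly (m : nat) (q : {poly R[i]}) : {poly R[i]} :=
  \poly_(i < m.+1) conjc q`_(m - i).

Lemma horner_reversed_poly (m : nat) (q : {poly R[i]}) (z : R[i]) :
  (size q <= m.+1)%N -> z != 0 ->
  (reversed_poly m q).[z] = z ^+ m * conjc q.[(conjc z)^-1].
Proof.
move=> sq z0; rewrite horner_poly (horner_coef_wide _ sq) rmorph_sum mulr_sumr.
rewrite (reindex_inj rev_ord_inj) /=; apply: eq_bigr => i _.
have im : (i <= m)%N by rewrite -ltnS.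
rewrite subSS subKn// rmorphM rmorphXn /= conjc_inv conjcK exprVn.
by rewrite mulrCA; congr (_ * _); rewrite expfB_cond ?(negPf z0).
Qed.

Definition is_POPUC (mu : measureR) (n : nat) (b : R[i])
    (P : {poly R[i]}) : Prop :=
  unit_circle b /\
  exists Q : nat -> {poly R[i]}, orthogonal_polys mu n Q /\
    P = 'X * Q n.-1 - (conjc b)%:P * reversed_poly n.-1 (Q n.-1).

Definition zeros_labelled (n : nat) (P : {poly R[i]}) (phi : nat -> R) : Prop :=
  [/\ forall k, (1 <= k <= n)%N -> - pi <= phi k < pi,
      {in [pred k | (1 <= k <= n)%N] &, injective (fun k => cis (phi k))}
    & forall z, root P z <-> exists2 k, (1 <= k <= n)%N & z = cis (phi k)].

End CircleMeasure.

Section Weights.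
Variable R : realType.

Definition s_tilde (phi : R -> R) (theta t : R) : R :=
  2^-1 * (1 / (cos (phi t) - cos theta)).

Definition S_tilde (n : nat) (phi : R -> R) (phi_ : nat -> R -> R)
    (theta t : R) : R :=
  sin theta / (cos theta - cos (phi t)) +
  \sum_(1 <= k < n.-1) cot ((phi_ k t - theta) / 2).

Definition W_tilde (n : nat) (phi : R -> R) (phi_ : nat -> R -> R)
    (gamma omega : R -> R) (t : R) : R :=
  s_tilde phi (omega t) t * derive1 gamma t -
  gamma t * s_tilde phi (omega t) t * S_tilde n phi phi_ (omega t) t *
    derive1 omega t.

End Weights.

(* Main.v *)
Require Import Defs.
From HB Require Import structures.
From mathcomp Require Import all_boot all_order all_algebra.
From mathcomp Require Import all_classical all_reals all_analysis.
From mathcomp Require Import measurable_realfun complex.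
From mathcomp Require Import ring lra.

Set Implicit Arguments.
Unset Strict Implicit.
Unset Printing Implicit Defensive.

Import Order.TTheory GRing.Theory Num.Theory.
Import numFieldNormedType.Exports.

Local Open Scope classical_set_scope.
Local Open Scope complex_scope.
Local Open Scope ring_scope.

(** Write c = cos phi, which is the real part of zeta. Since phi lies in ]0, pi[,
zeta moves counterclockwise exactly when c decreases, so everything reduces to
the sign of c'.

On the circle the factors of the conjugate pair satisfy
(z - zeta) (z - conj zeta) = 2 z (cos theta - c). Therefore, writing
P = (z - zeta) (z - conj zeta) D, the paraorthogonality of P (it is orthogonal to
z, ..., z^(n-1)) says that D, of degree n - 2, is orthogonal to all polynomials of
degree at most n - 2 for the signed weight gamma_j (cos omega_j - c)
(popuc_deflation). In particular the sum over j of
gamma_j (cos omega_j - c) |D (exp (i omega_j))|^2 is 0 at every time.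

This identity is to be differentiated at a time t without knowing how the
zeros of D move. The coefficients of D solve a linear system with
differentiable entries; it is nonsingular because pairing a polynomial E with
(z - c) E has real part sum_j gamma_j (cos omega_j - c)^2 |E (exp (i omega_j))|^2
(tilted_definite), which is positive unless E vanishes at all the masses. By Cramer's rule they
are differentiable (orthogonal_coef_cderivable). Moreover, replacing D at time s by
D at time t changes the sum only to second order, by orthogonality
(frozen_form_is_derive0). So D may be frozen at time t, and the derivative of the
sum is still 0.

With D frozen, g_j = |D (exp (i omega_j))|^2 is a product of chords whose
logarithmic derivative is a sum of cotangents, and the vanishing derivative
reads (cos_velocity)
c' * sum_j gamma_j g_j = - 2 * sum_j g_j (cos omega_j - c)^2 W_j.
The omega_j avoid the zeros of P, so all the g_j and (cos omega_j - c)^2 are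
positive, and sum_j gamma_j g_j is positive because some mass is. Thus c' has
the sign opposite to that of the W_j, and the mean value theorem concludes. *)

(** * Differentiability of complex functions of a real variable *)

Section ComplexDerivable.
Variable R : realType.
Implicit Types (f g : R -> R[i]) (t : R).

Lemma complex_ReM (x y : R[i]) : complex.Re (x * y) =
  complex.Re x * complex.Re y - complex.Im x * complex.Im y.
Proof. by case: x; case: y. Qed.

Lemma complex_ImM (x y : R[i]) : complex.Im (x * y) =
  complex.Re x * complex.Im y + complex.Im x * complex.Re y.
Proof. by case: x; case: y. Qed.

Lemma complex_ReD (x y : R[i]) :
  complex.Re (x + y) = complex.Re x + complex.Re y.
Proof. by case: x; case: y. Qed.

Lemma complex_ImD (x y : R[i]) :
  complex.Im (x + y) = complex.Im x + complex.Im y.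
Proof. by case: x; case: y. Qed.

Lemma conjcD (x y : R[i]) : conjc (x + y) = conjc x + conjc y.
Proof. exact: rmorphD. Qed.

Lemma conjcM (x y : R[i]) : conjc (x * y) = conjc x * conjc y.
Proof. exact: rmorphM. Qed.

Lemma conjcR (x : R) : conjc x%:C = x%:C.
Proof. exact: conjc_real. Qed.

Lemma complex_Re_sum (I : Type) (r : seq I) (F : I -> R[i]) :
  complex.Re (\sum_(i <- r) F i) = \sum_(i <- r) complex.Re (F i).
Proof. exact: (big_morph _ complex_ReD (erefl _)). Qed.

Lemma complex_Im_sum (I : Type) (r : seq I) (F : I -> R[i]) :
  complex.Im (\sum_(i <- r) F i) = \sum_(i <- r) complex.Im (F i).
Proof. exact: (big_morph _ complex_ImD (erefl _)). Qed.

Lemma eq_cderivable f g t : f =1 g -> cderivable f t -> cderivable g t.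
Proof. by move=> /funext->. Qed.

Lemma near_eq_cderivable f g t :
  {near t, f =1 g} -> cderivable f t -> cderivable g t.
Proof.
by move=> fg [fRe fIm]; split; [move: fRe|move: fIm];
  apply: near_eq_derivable; near=> s; congr (_ _); near: s.
Unshelve. all: by end_near. Qed.

Lemma cderivable_cst (z : R[i]) t : cderivable (fun=> z) t.
Proof. by split; exact: derivable_cst. Qed.

Lemma cderivable_real (h : R -> R) t :
  derivable h t 1 -> cderivable (fun s => (h s)%:C) t.
Proof. by move=> dh; split; [exact: dh|exact: derivable_cst]. Qed.

Lemma cderivableD f g t :
  cderivable f t -> cderivable g t -> cderivable (fun s => f s + g s) t.
Proof.
move=> [fRe fIm] [gRe gIm]; split.
- under eq_fun do rewrite complex_ReD; exact: derivableD.
- under eq_fun do rewrite complex_ImD; exact: derivableD.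
Qed.

Lemma cderivableN f t : cderivable f t -> cderivable (fun s => - f s) t.
Proof.
move=> [fRe fIm]; split.
- under eq_fun do rewrite raddfN /=; exact: derivableN.
- under eq_fun do rewrite raddfN /=; exact: derivableN.
Qed.

Lemma cderivableB f g t :
  cderivable f t -> cderivable g t -> cderivable (fun s => f s - g s) t.
Proof. by move=> df dg; apply/cderivableD/cderivableN. Qed.

Lemma cderivableM f g t :
  cderivable f t -> cderivable g t -> cderivable (fun s => f s * g s) t.
Proof.
move=> [fRe fIm] [gRe gIm]; split.
- under eq_fun do rewrite complex_ReM.
  exact: derivableB (derivableM fRe gRe) (derivableM fIm gIm).
- under eq_fun do rewrite complex_ImM.
  exact: derivableD (derivableM fRe gIm) (derivableM fIm gRe).
Qed.

Lemma cderivable_conj f t : cderivable f t -> cderivable (fun s => conjc (f s)) t.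
Proof.
move=> [fRe fIm]; split.
- suff -> : (fun s => complex.Re (conjc (f s))) = (@complex.Re R \o f) by exact: fRe.
  by apply/funext => s /=; case: (f s).
- suff -> : (fun s => complex.Im (conjc (f s))) = - (@complex.Im R \o f).
    exact: derivableN.
  by apply/funext => s /=; rewrite fctE /=; case: (f s).
Qed.

Lemma cderivableV f t :
  f t != 0 -> cderivable f t -> cderivable (fun s => (f s)^-1) t.
Proof.
move=> ft0 df; pose n2 s := complex.Re (f s * conjc (f s)).
have n2E s : n2 s = complex.Re (f s) ^+ 2 + complex.Im (f s) ^+ 2.
  by rewrite /n2; case: (f s) => x y /=; rewrite mulrN opprK !expr2.
have dn2 : derivable n2 t 1 := (cderivableM df (cderivable_conj df)).1.
have n2t0 : n2 t != 0.
  rewrite n2E; move: ft0; case: (f t) => x y; apply: contraNneq => /= /eqP.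
  by rewrite paddr_eq0 ?sqr_ge0// !sqrf_eq0 => /andP[/eqP-> /eqP->].
apply: eq_cderivable (cderivableM (cderivable_conj df)
  (cderivable_real (derivableV n2t0 dn2))) => s /=; rewrite n2E.
by case: (f s) => x y; apply/eqP; rewrite eq_complex /= !mulr0 subr0 add0r mulNr !eqxx.
Qed.

Lemma cderivable_sum (I : Type) (r : seq I) (F : I -> R -> R[i]) t :
  (forall i, cderivable (F i) t) -> cderivable (fun s => \sum_(i <- r) F i s) t.
Proof.
move=> dF; elim: r => [|i r IH].
  by apply: eq_cderivable (cderivable_cst 0 t) => s; rewrite big_nil.
by apply: eq_cderivable (cderivableD (dF i) IH) => s; rewrite big_cons.
Qed.

Lemma cderivable_prod (I : Type) (r : seq I) (F : I -> R -> R[i]) t :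
  (forall i, cderivable (F i) t) -> cderivable (fun s => \prod_(i <- r) F i s) t.
Proof.
move=> dF; elim: r => [|i r IH].
  by apply: eq_cderivable (cderivable_cst 1 t) => s; rewrite big_nil.
by apply: eq_cderivable (cderivableM (dF i) IH) => s; rewrite big_cons.
Qed.

Lemma cderivable_horner (p : {poly R[i]}) f t :
  cderivable f t -> cderivable (fun s => p.[f s]) t.
Proof.
move=> df; elim/poly_ind: p => [|p c IH].
  by apply: eq_cderivable (cderivable_cst 0 t) => s; rewrite horner0.
by apply: eq_cderivable (cderivableD (cderivableM IH df) (cderivable_cst c t))
  => s; rewrite hornerMXaddC.
Qed.

Lemma cderivable_cis (h : R -> R) t :
  derivable h t 1 -> cderivable (fun s => cis (h s)) t.
Proof.
move=> /derivableP dh; split=> /=.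
- by have [dcos _] := is_derive1_comp (is_derive_cos (h t)) dh.
- by have [dsin _] := is_derive1_comp (is_derive_sin (h t)) dh.
Qed.

Lemma cderivable_det (m : nat) (A : R -> 'M[R[i]]_m) t :
  (forall i j, cderivable (fun s => A s i j) t) ->
  cderivable (fun s => \det (A s)) t.
Proof.
move=> dA; rewrite /determinant; apply: cderivable_sum => sg.
by apply: cderivableM (cderivable_cst _ _) _; exact: cderivable_prod.
Qed.

(** Cramer's rule expresses the solution through minors of the matrix, so
differentiability of the data passes to the solution without any a priori
bound on it. *)
Lemma cderivable_linear_system (m : nat) (A : R -> 'M[R[i]]_m)
    (v x : R -> 'rV[R[i]]_m) t :
  (forall i j, cderivable (fun s => A s i j) t) ->
  (forall j, cderivable (fun s => v s 0 j) t) ->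
  (\near t, \det (A t) != 0 /\ x t *m A t = v t) ->
  forall j, cderivable (fun s => x s 0 j) t.
Proof.
move=> dA dv xAv j; apply: (@near_eq_cderivable
    (fun s => (\det (A s))^-1 * \sum_k v s 0 k * \adj (A s) k j)); last first.
  apply: cderivableM.
    by apply: cderivableV (cderivable_det dA); case: (nbhs_singleton xAv).
  apply: cderivable_sum => k; apply: cderivableM => //.
  under eq_fun do rewrite mxE; apply: cderivableM; first exact: cderivable_cst.
  by apply: cderivable_det => a b; under eq_fun do rewrite !mxE.
near=> s.
have [detA <-] : \det (A s) != 0 /\ x s *m A s = v s by near: s.
transitivity ((\det (A s))^-1 * (x s *m A s *m \adj (A s)) 0 j).
  by rewrite [in RHS]mxE.
by rewrite -mulmxA mul_mx_adj mul_mx_scalar mxE mulKf.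
Unshelve. all: by end_near. Qed.

End ComplexDerivable.

(** * Integration against point masses *)

Section PointMasses.
Variable R : realType.
Implicit Types (p q : {poly R[i]}).

(** The inner product of L^2 of the measure with masses w at the points
exp (i x), which need not be positive: signed weights are used as well. *)
Definition pform (I : finType) (w x : I -> R) p q : R[i] :=
  \sum_i (w i)%:C * (p.[cis (x i)] * conjc q.[cis (x i)]).

Section PositiveWeights.
Variables (N : nat) (gamma omega : 'I_N.+1 -> R).
Variable mu : {measure set (measurableTypeR R) -> \bar R}.
Hypothesis mu_def : forall A, measurable A -> mu A = point_masses gamma omega A.

(** Distinct points of the circle have distinct parameters, so the mass of the
singleton at omega j is gamma j alone. *)
Lemma point_masses_weight_ge0 :
  injective (fun j => cis (omega j)) -> forall j, 0 <= gamma j.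
Proof.
move=> omega_inj j.
have mA : measurable ([set omega j] : set (measurableTypeR R)).
  exact: measurable_set1.
rewrite -lee_fin.
suff <- : mu [set omega j] = (gamma j)%:E by exact: measure_ge0.
rewrite mu_def// /point_masses (bigD1 j)//= diracE mem_set// mule1.
rewrite big1 ?adde0// => i ij; rewrite diracE memNset ?mule0//= => oij.
by move: ij; rewrite (omega_inj i j) ?eqxx//= oij.
Qed.

Hypothesis gamma_ge0 : forall j, 0 <= gamma j.

Lemma ge0_integral_point_masses (f : measurableTypeR R -> \bar R) :
  (forall x, 0 <= f x)%E -> measurable_fun [set: measurableTypeR R] f ->
  (\int[mu]_x f x = \sum_(j < N.+1) (gamma j)%:E * f (omega j))%E.
Proof.
move=> f0 mf.
pose m_ (k : nat) : {measure set (measurableTypeR R) -> \bar R} :=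
  mscale (NngNum (gamma_ge0 (inord k)))
         (\d_(omega (inord k) : measurableTypeR R)).
rewrite (eq_measure_integral (msum m_ N.+1)); last first.
  move=> A mA _; rewrite mu_def// /point_masses /msum.
  by apply: eq_bigr => j _; rewrite /m_ /mscale /= inord_val.
rewrite ge0_integral_measure_sum//; apply: eq_bigr => j _.
rewrite ge0_integral_mscale//= integral_dirac//.
by rewrite diracE mem_set// mul1e inord_val.
Qed.

Lemma Rintegral_point_masses (f : measurableTypeR R -> R) :
  measurable_fun [set: measurableTypeR R] f ->
  \int[mu]_x f x = \sum_(j < N.+1) gamma j * f (omega j).
Proof.
move=> mf; have mEf : measurable_fun [set: measurableTypeR R] (EFin \o f) by exact/measurable_EFinP.
rewrite /Rintegral integralE.
rewrite !ge0_integral_point_masses//; [|exact: measurable_funeneg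
  |exact: measurable_funepos].
under eq_bigr do rewrite funeposE -EFin_max -EFinM.
under [X in (_ - X)%E]eq_bigr do rewrite funenegE -EFinN -EFin_max -EFinM.
rewrite !sumEFin.
rewrite -EFinB /= -sumrB; apply: eq_bigr => j _; rewrite -mulrBr; congr (_ * _).
by case: (leP 0 (f (omega j))) => h;
  [rewrite max_r ?subr0// oppr_le0|rewrite max_l ?sub0r ?opprK// oppr_ge0 ltW].
Qed.

(** Differentiability serves here only to make the real and imaginary parts
measurable. *)
Lemma cintegral_point_masses (f : R -> R[i]) :
  (forall t, cderivable f t) ->
  cintegral mu f = \sum_(j < N.+1) (gamma j)%:C * f (omega j).
Proof.
move=> df; have meas (h : R -> R) : (forall t, derivable h t 1) ->
    measurable_fun [set: measurableTypeR R] (h : measurableTypeR R -> R).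
  move=> dh; apply: continuous_measurable_fun => x.
  exact/differentiable_continuous/derivable1_diffP.
rewrite /cintegral !Rintegral_point_masses//; try by apply: meas => t; case: (df t).
apply/eqP; rewrite eq_complex complex_Re_sum complex_Im_sum; apply/andP; split; apply/eqP.
- by apply: eq_bigr => j _; rewrite complex_ReM /= mul0r subr0.
- by apply: eq_bigr => j _; rewrite complex_ImM /= mul0r addr0.
Qed.

Lemma cintegral_pform p q :
  cintegral mu (fun x => p.[cis x] * conjc q.[cis x]) = pform gamma omega p q.
Proof.
apply: cintegral_point_masses => t.
have dcis : cderivable (@cis R) t by exact: (@cderivable_cis R id).
by apply: cderivableM; [|apply: cderivable_conj]; exact: cderivable_horner.
Qed.

End PositiveWeights.
End PointMasses.

(** * Orthogonality and paraorthogonality on the circle *)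

Lemma size_sub_lead (F : fieldType) (k : nat) (f g : {poly F}) :
  (size f <= k.+1)%N -> g \is monic -> size g = k.+1 ->
  (size (f - f`_k *: g)%R <= k)%N.
Proof.
move=> sf /monicP; rewrite lead_coefE => + sg; rewrite sg /= => gk.
apply/leq_sizeP => j kj; rewrite coefB coefZ.
have [->|jk] := eqVneq j k; first by rewrite gk mulr1 subrr.
have k1j : (k < j)%N by rewrite ltn_neqAle eq_sym jk.
by rewrite (nth_default _ (leq_trans sf k1j)) (nth_default 0) ?sg// mulr0 subr0.
Qed.

Section DiscreteForm.
Variables (R : realType) (I : finType).
Implicit Types (w x : I -> R) (p q : {poly R[i]}) (a : R[i]).

Lemma cis_conjM (y : R) : cis y * conjc (cis y) = 1.
Proof.
apply/eqP; rewrite eq_complex /= mulrN opprK -!expr2 cos2Dsin2 eqxx /=.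
by rewrite mulrN mulrC addNr.
Qed.

Lemma cis_neq0 (y : R) : cis y != 0.
Proof. by apply: contra_eq_neq (cis_conjM y) => ->; rewrite mul0r eq_sym oner_neq0. Qed.

Lemma conjcis (y : R) : conjc (cis y) = cis (- y).
Proof. by rewrite /cis cosN sinN. Qed.

Lemma conj_cisV (y : R) : (conjc (cis y))^-1 = cis y.
Proof. by rewrite -[LHS]mul1r -(cis_conjM y) mulfK// conjc_eq0 cis_neq0. Qed.

Lemma pformDl w x p1 p2 q :
  pform w x (p1 + p2) q = pform w x p1 q + pform w x p2 q.
Proof. by rewrite -big_split; apply: eq_bigr => i _; rewrite hornerD mulrDl mulrDr. Qed.

Lemma pformZl w x a p q : pform w x (a *: p) q = a * pform w x p q.
Proof. by rewrite mulr_sumr; apply: eq_bigr => i _; rewrite hornerZ; ring. Qed.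

Lemma pform_conj w x p q : conjc (pform w x p q) = pform w x q p.
Proof.
rewrite rmorph_sum; apply: eq_bigr => i _; rewrite /= !conjcM conjcR conjcK.
by rewrite [conjc _ * _]mulrC.
Qed.

Lemma pformDr w x p q1 q2 :
  pform w x p (q1 + q2) = pform w x p q1 + pform w x p q2.
Proof. by rewrite -!(pform_conj w x _ p) pformDl conjcD. Qed.

Lemma pformZr w x a p q : pform w x p (a *: q) = conjc a * pform w x p q.
Proof. by rewrite -!(pform_conj w x _ p) pformZl conjcM. Qed.

Lemma pform0l w x q : pform w x 0 q = 0.
Proof. by rewrite -(scale0r 0) pformZl mul0r. Qed.

Lemma pform0r w x p : pform w x p 0 = 0.
Proof. by rewrite -pform_conj pform0l conjc0. Qed.

Lemma pform_suml w x (J : Type) (r : seq J) (F : J -> {poly R[i]}) q :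
  pform w x (\sum_(j <- r) F j) q = \sum_(j <- r) pform w x (F j) q.
Proof. exact: (big_morph (pform w x ^~ q) (fun p1 p2 => pformDl w x p1 p2 q) (pform0l w x q)). Qed.

Lemma pform_sumr w x (J : Type) (r : seq J) (F : J -> {poly R[i]}) p :
  pform w x p (\sum_(j <- r) F j) = \sum_(j <- r) pform w x p (F j).
Proof. exact: (big_morph (pform w x p) (pformDr w x p) (pform0r w x p)). Qed.

Definition pform_orthogonal w x (n : nat) (Q : nat -> {poly R[i]}) : Prop :=
  forall m, (m < n)%N ->
    [/\ Q m \is monic, size (Q m) = m.+1,
        forall l, (l < n)%N -> l <> m -> pform w x (Q m) (Q l) = 0
      & pform w x (Q m) (Q m) <> 0].

Lemma pform_orthogonal_lower w x n Q m p :
  pform_orthogonal w x n Q -> (m < n)%N -> (size p <= m)%N ->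
  pform w x (Q m) p = 0.
Proof.
move=> oQ mn; have [_ _ oQm _] := oQ m mn.
suff H k : (k <= m)%N -> forall p, (size p <= k)%N -> pform w x (Q m) p = 0.
  exact: (H m).
elim: k => [_ f|k IH km f sf]; first by rewrite leqn0 size_poly_eq0 => /eqP->; exact: pform0r.
have kn : (k < n)%N := ltn_trans km mn.
have [monQk sQk _ _] := oQ k kn.
rewrite -(subrK (f`_k *: Q k) f) pformDr pformZr oQm//; last first.
  by move=> E; rewrite E ltnn in km.
by rewrite mulr0 addr0; apply: IH (ltnW km) _ _; exact: size_sub_lead.
Qed.

(** If p of degree m vanishes at all the masses, its inner product with Q m is zero;
but it is also the leading coefficient of p times the nonzero norm of Q m. So the
orthogonal polynomials themselves witness that there are enough masses. *)
Lemma pform_separates w x n Q p :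
  pform_orthogonal w x n Q -> (size p <= n)%N ->
  (forall i, w i != 0 -> p.[cis (x i)] = 0) -> p = 0.
Proof.
move=> oQ sp p0; apply/eqP/negPn/negP => pn0.
have sm : size p = (size p).-1.+1 by rewrite prednK// size_poly_gt0.
have mn : ((size p).-1 < n)%N by rewrite -sm.
have [monQ sQ _] := oQ _ mn; apply.
have sl : (size (p - lead_coef p *: Q (size p).-1)%R <= (size p).-1)%N.
  by apply: size_sub_lead => //; rewrite -sm.
have : pform w x p (Q (size p).-1) = 0.
  apply: big1 => i _; have [->|wi] := eqVneq (w i) 0; first by rewrite mul0r.
  by rewrite p0// mul0r mulr0.
rewrite -{1}(subrK (lead_coef p *: Q (size p).-1) p) pformDl pformZl.
rewrite -pform_conj (pform_orthogonal_lower oQ)// conjc0 add0r => /eqP.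
by rewrite mulf_eq0 lead_coef_eq0 (negPf pn0) /= => /eqP.
Qed.

Lemma pform_mulX w x p q : pform w x ('X * p) ('X * q) = pform w x p q.
Proof.
apply: eq_bigr => i _; rewrite !hornerM !hornerX conjcM mulrACA.
by rewrite cis_conjM mul1r.
Qed.

Lemma horner_reversed_cis m q (y : R) : (size q <= m.+1)%N ->
  (reversed_poly m q).[cis y] = cis y ^+ m * conjc q.[cis y].
Proof. by move=> sq; rewrite horner_reversed_poly ?cis_neq0// conj_cisV. Qed.

(** On the circle, reversing a polynomial is conjugation up to a power of z,
so orthogonality of the reversed polynomial to the multiples of z is that of
the polynomial itself to lower degrees. *)
Lemma pform_reversed w x n Q q : (0 < n)%N ->
  pform_orthogonal w x n Q -> (size q <= n.-1)%N ->
  pform w x (reversed_poly n.-1 (Q n.-1)) ('X * q) = 0.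
Proof.
move=> n0 oQ; have n1n : (n.-1 < n)%N by rewrite prednK.
have [_ sQ _ _] := oQ _ n1n.
case nE : n.-1 => [|k] sq.
  by move: sq; rewrite leqn0 size_poly_eq0 => /eqP->; rewrite mulr0 pform0r.
rewrite -nE; transitivity (pform w x (reversed_poly k q) (Q n.-1)).
  apply: eq_bigr => i _; congr (_ * _).
  rewrite !horner_reversed_cis// ?sQ// hornerM hornerX conjcM nE exprSr.
  transitivity (cis (x i) * conjc (cis (x i)) *
    (cis (x i) ^+ k * conjc q.[cis (x i)] * conjc (Q k.+1).[cis (x i)])).
    by ring.
  by rewrite cis_conjM mul1r.
rewrite -pform_conj (pform_orthogonal_lower oQ) ?conjc0// nE.
exact: size_poly.
Qed.

(** The factor z of the test polynomials cancels the one in front of the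
orthogonal polynomial, and the reversed polynomial is orthogonal to them by the
symmetry above, whatever the parameter b. *)
Lemma paraorthogonal w x n Q b q : (0 < n)%N ->
  pform_orthogonal w x n Q -> (size q <= n.-1)%N ->
  pform w x ('X * Q n.-1 - b%:P * reversed_poly n.-1 (Q n.-1)) ('X * q) = 0.
Proof.
move=> n0 oQ sq; rewrite mul_polyC -scaleNr pformDl pformZl pform_reversed//.
rewrite pform_mulX mulr0 addr0.
by rewrite (pform_orthogonal_lower oQ)// prednK.
Qed.

Lemma paraorthogonal_monic_size (n : nat) (b : R[i]) p : (0 < n)%N ->
  p \is monic -> size p = n ->
  let P := 'X * p - b%:P * reversed_poly n.-1 p in
  P \is monic /\ size P = n.+1.
Proof.
move=> n0 monp sp P.
have sXp : size ('X * p) = n.+1 by rewrite mulrC size_mulX ?sp// monic_neq0.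
have lt : (size (- (b%:P * reversed_poly n.-1 p))%R < size ('X * p)%R)%N.
  rewrite sXp ltnS size_polyN mul_polyC (leq_trans (size_scale_leq _ _))//.
  by rewrite (leq_trans (size_poly _ _))// prednK.
split; last by rewrite size_polyDl.
by rewrite monicE lead_coefDl// mulrC lead_coefMX.
Qed.

End DiscreteForm.

(** * Removing a conjugate pair of zeros *)

Section Deflation.
Variable R : realType.
Implicit Types (P D G : {poly R[i]}).

Lemma orthogonal_polys_pform (N : nat) (gamma omega : 'I_N.+1 -> R)
    (mu : {measure set (measurableTypeR R) -> \bar R}) n Q :
  (forall A, measurable A -> mu A = point_masses gamma omega A) ->
  (forall j, 0 <= gamma j) ->
  orthogonal_polys mu n Q -> pform_orthogonal gamma omega n Q.
Proof.
move=> mu_def gamma_ge0 oQ m mn; have [monQ sQ oQm nQm] := oQ m mn.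
split=> // [l ln lm|]; rewrite -(cintegral_pform mu_def gamma_ge0).
  exact: oQm.
suff <- : (fun x => `|(Q m).[cis x]| ^+ 2) =
  (fun x => (Q m).[cis x] * conjc (Q m).[cis x]) by [].
by apply/funext => x; rewrite sqr_normc.
Qed.

Lemma zeros_labelled_factor n P (phi : nat -> R) :
  P \is monic -> size P = n.+1 -> zeros_labelled n P phi ->
  P = \prod_(1 <= k < n.+1) ('X - (cis (phi k))%:P).
Proof.
move=> /monicP lcP sP [_ phi_inj phi_roots].
pose rs := [seq cis (phi k) | k <- index_iota 1 n.+1].
have -> : P = lead_coef P *: \prod_(z <- rs) ('X - z%:P); last first.
  by rewrite lcP scale1r /rs big_map.
apply: all_roots_prod_XsubC.
- by rewrite size_map size_iota subn1.
- apply/allP => _ /mapP[k kn ->]; apply/phi_roots; exists k => //.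
  by rewrite mem_index_iota ltnS in kn.
- rewrite uniq_rootsE map_inj_in_uniq ?iota_uniq// => k l.
  by rewrite !mem_index_iota !ltnS; exact: phi_inj.
Qed.

(** The paraorthogonal polynomial divided by the factors of its last two labelled
zeros, which form the conjugate pair. *)
Definition deflated n (phi : nat -> R) : {poly R[i]} :=
  \prod_(1 <= k < n.-1) ('X - (cis (phi k))%:P).

Lemma deflated_monic n phi : deflated n phi \is monic.
Proof. exact: monic_prod_XsubC. Qed.

Lemma size_deflated n phi : size (deflated n phi) = n.-2.+1.
Proof. by rewrite size_prod_XsubC size_iota subn1. Qed.

(** A conjugate pair of factors is real on the circle up to the factor z, which
is the one that the test polynomials z G of paraorthogonality supply. *)
Lemma conj_pair_factor (x y : R) :
  (cis y - cis x) * (cis y - cis (- x)) * conjc (cis y) =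
  (2 * (cos y - cos x))%:C.
Proof.
transitivity (cis y * (cis y * conjc (cis y)) - cis y * conjc (cis y) *
  (cis x + conjc (cis x)) + cis x * conjc (cis x) * conjc (cis y)).
  by rewrite -conjcis; ring.
rewrite !cis_conjM mulr1 !mul1r; apply/eqP; rewrite eq_complex /=.
by apply/andP; split; apply/eqP; ring.
Qed.

Lemma deflated_orthogonal (I : finType) (gamma x : I -> R) P (y : R) D G :
  P = D * ('X - (cis (- y))%:P) * ('X - (cis y)%:P) ->
  pform gamma x P ('X * G) = 0 ->
  pform (fun i => gamma i * (cos (x i) - cos y)) x D G = 0.
Proof.
move=> -> h; apply: (mulfI (_ : 2 != 0)); first by rewrite pnatr_eq0.
rewrite mulr0 -[RHS]h mulr_sumr; apply: eq_bigr => i _.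
rewrite !hornerM hornerX !hornerXsubC conjcM.
transitivity ((gamma i)%:C * ((2 * (cos (x i) - cos y))%:C *
    (D.[cis (x i)] * conjc G.[cis (x i)]))).
  by rewrite !rmorphM /=; ring.
by rewrite -conj_pair_factor; ring.
Qed.

End Deflation.

(** * Derivatives of products of chords *)

Section RealDerivative.
Variable R : realType.
Implicit Types (f g h : R -> R) (t : R).

(** Real-valued, unlike the square of the norm, so that it can be
differentiated. *)
Definition sqmod (z : R[i]) : R := complex.Re z ^+ 2 + complex.Im z ^+ 2.

Lemma sqmodE (z : R[i]) : (sqmod z)%:C = z * conjc z.
Proof.
case: z => a b; apply/eqP; rewrite eq_complex /sqmod /=.
by apply/andP; split; apply/eqP; ring.
Qed.

Lemma sqmodM (z1 z2 : R[i]) : sqmod (z1 * z2) = sqmod z1 * sqmod z2.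
Proof. by case: z1 z2 => a b [a' b']; rewrite /sqmod /=; ring. Qed.

Lemma sqmod_cisB (x y : R) : sqmod (cis x - cis y) = 2 - 2 * cos (x - y).
Proof.
rewrite cosB /sqmod /=.
transitivity ((cos x ^+ 2 + sin x ^+ 2) + (cos y ^+ 2 + sin y ^+ 2) -
  2 * (cos x * cos y + sin x * sin y)); first by ring.
by rewrite !cos2Dsin2; ring.
Qed.

Lemma is_derive_big (J : Type) (r : seq J) (F : J -> R -> R) (dF : J -> R) t :
  (forall j, is_derive t 1 (F j) (dF j)) ->
  is_derive t 1 (fun s => \sum_(j <- r) F j s) (\sum_(j <- r) dF j).
Proof.
move=> dFj; elim: r => [|j r IH].
  have -> : (fun s => \sum_(j <- [::]) F j s) = cst 0.
    by apply/funext => s; rewrite big_nil.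
  by rewrite big_nil; exact: is_derive_cst.
have -> : (fun s => \sum_(i <- j :: r) F i s) =
    F j + (fun s => \sum_(i <- r) F i s).
  by apply/funext => s; rewrite big_cons.
by rewrite big_cons; exact: is_deriveD.
Qed.

Lemma is_derive_mul0 f g t : derivable f t 1 -> derivable g t 1 ->
  f t = 0 -> g t = 0 -> is_derive t 1 (fun s => f s * g s) 0.
Proof.
move=> /derivableP df /derivableP dg f0 g0.
apply: is_derive_eq (is_deriveM df dg) _.
by rewrite f0 g0 !scale0r addr0.
Qed.

(** The hypothesis is a logarithmic derivative, written without division so
that the lemma holds also where a factor vanishes. *)
Lemma is_derive_prod (J : eqType) (r : seq J) (F : J -> R -> R) (l : J -> R) t :
  (forall j, j \in r -> is_derive t 1 (F j) (F j t * l j)) ->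
  is_derive t 1 (fun s => \prod_(j <- r) F j s)
    (\prod_(j <- r) F j t * \sum_(j <- r) l j).
Proof.
elim: r => [_|j r IH dF].
  have -> : (fun s => \prod_(j <- [::]) F j s) = cst 1.
    by apply/funext => s; rewrite big_nil.
  by rewrite !big_nil mulr0; exact: is_derive_cst.
have -> : (fun s => \prod_(i <- j :: r) F i s) =
    F j * (fun s => \prod_(i <- r) F i s).
  by apply/funext => s; rewrite big_cons.
have dr := IH (fun i ir => dF i (mem_behead (s := j :: r) ir)).
apply: is_derive_eq (is_deriveM (dF j (mem_head j r)) dr) _.
by rewrite !big_cons /GRing.scale /=; ring.
Qed.

Lemma is_derive_chord (x y : R) : sin ((y - x) / 2) != 0 ->
  is_derive x 1 (fun z => 2 - 2 * cos (z - y))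
    ((2 - 2 * cos (x - y)) * - cot ((y - x) / 2)).
Proof.
move=> sn0.
have dB : is_derive x 1 (fun z => z - y) 1.
  by apply: is_derive_eq (is_deriveB (is_derive_id x 1) (is_derive_cst y x 1)) _;
    rewrite subr0.
have dcos := @is_derive1_comp _ cos (fun z => z - y) x _ _
  (is_derive_cos (x - y)) dB.
have df := is_deriveB (is_derive_cst (2 : R) x 1) (is_deriveZ (2 : R) dcos).
apply: is_derive_eq df _.
rewrite /cot -[x - y]opprB cosN sinN.
have -> : y - x = (y - x) / 2 + (y - x) / 2 by field.
set a := (y - x) / 2 in sn0 *; rewrite cosD sinD.
have -> : (a + a) / 2 = a by field.
have c2 : cos a ^+ 2 = 1 - sin a ^+ 2 by rewrite sin2cos2; ring.
rewrite /GRing.scale /= -!expr2 c2; field; exact: sn0.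
Qed.

End RealDerivative.

Lemma pform_diag (R : realType) (I : finType) (w x : I -> R) (p : {poly R[i]}) :
  pform w x p p = (\sum_i w i * sqmod p.[cis (x i)])%:C.
Proof.
by rewrite rmorph_sum; apply: eq_bigr => i _ /=; rewrite rmorphM /= sqmodE.
Qed.

(** * The tilted form and its first variation *)

Section TiltedForm.
Variables (R : realType) (I : finType).

(** The weight left over when the pair of conjugate zeros is absorbed into the
measure; it may take both signs. *)
Definition tilted (gamma x : I -> R) (c : R) (i : I) : R :=
  gamma i * (cos (x i) - c).

(** The tilted weight is signed, but testing D against (z - c) D restores
positivity: on the circle the real part of z - c is cos theta - c, so the real
part of the pairing has the weight gamma (cos theta - c)^2. *)
Lemma tilted_definite (gamma x : I -> R) (c : R) (D : {poly R[i]}) :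
  (forall i, 0 <= gamma i) -> (forall i, cos (x i) != c) ->
  pform (tilted gamma x c) x D (('X - (c%:C)%:P) * D) = 0 ->
  forall i, gamma i != 0 -> D.[cis (x i)] = 0.
Proof.
move=> gamma_ge0 xc h.
pose n2 i := sqmod D.[cis (x i)].
have n2_ge0 i : 0 <= n2 i by rewrite addr_ge0// sqr_ge0.
have : \sum_i gamma i * (cos (x i) - c) ^+ 2 * n2 i = 0.
  rewrite -[RHS](congr1 (@complex.Re R) h) complex_Re_sum.
  apply: eq_bigr => i _; rewrite hornerM hornerXsubC /tilted /n2 /sqmod.
  by case: D.[_] => a b /=; ring.
move/eqP; rewrite psumr_eq0 => [/allP z i gi|i _]; last first.
  by apply: mulr_ge0 (n2_ge0 i); apply: mulr_ge0 (gamma_ge0 i) _; exact: sqr_ge0.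
have := z i (mem_index_enum i); rewrite /= !mulf_eq0 (negPf gi) subr_eq0.
rewrite (negPf (xc i)) /n2 /sqmod /= paddr_eq0 ?sqr_ge0// !sqrf_eq0.
by case: D.[_] => a b /= /andP[/eqP-> /eqP->].
Qed.

Variables (gamma x : I -> R -> R) (c : R -> R) (t : R).
Hypothesis dgamma : forall i, derivable (gamma i) t 1.
Hypothesis dx : forall i, derivable (x i) t 1.
Hypothesis dc : derivable c t 1.
Local Notation u := (fun s => tilted (gamma ^~ s) (x ^~ s) (c s)).

Lemma derivable_tilted i : derivable (fun s => u s i) t 1.
Proof.
have [dcos _] := cderivable_cis (@dx i).
exact: derivableM (@dgamma i) (derivableB dcos dc).
Qed.

Lemma cderivable_tilted_sum (f g : I -> R -> R[i]) :
  (forall i, cderivable (f i) t) -> (forall i, cderivable (g i) t) ->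
  cderivable (fun s => \sum_i (u s i)%:C * (f i s * conjc (g i s))) t.
Proof.
move=> df dg; apply: cderivable_sum => i.
apply: cderivableM (cderivableM (df i) (cderivable_conj (dg i))).
exact/cderivable_real/derivable_tilted.
Qed.

Variables (m : nat) (D : R -> {poly R[i]}).
Hypothesis D_monic : forall s, D s \is monic.
Hypothesis D_size : forall s, size (D s) = m.+1.
Hypothesis D_orthogonal : \near t, forall G : {poly R[i]}, (size G <= m.+1)%N ->
  pform (u t) (x ^~ t) (D t) G = 0.
Hypothesis u_nondegenerate : \near t, forall E : {poly R[i]}, (size E <= m)%N ->
  pform (u t) (x ^~ t) E (('X - ((c t)%:C)%:P) * E) = 0 -> E = 0.

Let test s (j : nat) : {poly R[i]} := ('X - ((c s)%:C)%:P) * 'X^j.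

(** Nothing is assumed about the motion of the individual zeros of D. Its lower
coefficients solve the m linear equations obtained by testing against
(z - c) z^j, and the system is nonsingular because a kernel vector is a polynomial
excluded by the nondegeneracy hypothesis. *)
Lemma orthogonal_coef_cderivable (i : 'I_m) : cderivable (fun s => (D s)`_i) t.
Proof.
have dcis k := cderivable_cis (@dx k).
have dXn k (j : nat) : cderivable (fun s => ('X^j : {poly R[i]}).[cis (x k s)]) t.
  exact: cderivable_horner.
have dtest k (j : nat) : cderivable (fun s => (test s j).[cis (x k s)]) t.
  under eq_fun do rewrite /test hornerM hornerXsubC.
  exact: cderivableM (cderivableB (dcis k) (cderivable_real dc)) (dXn k j).
pose A s : 'M[R[i]]_m := \matrix_(i, j) pform (u s) (x ^~ s) 'X^i (test s j).
pose v s : 'rV[R[i]]_m := \row_j - pform (u s) (x ^~ s) 'X^m (test s j).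
suff : cderivable (fun s => (poly_rV (D s) : 'rV[R[i]]_m) 0 i) t.
  by apply: eq_cderivable => s; rewrite mxE.
apply: (@cderivable_linear_system _ _ A v) => [a b|b|].
- under eq_fun do rewrite mxE.
  exact: cderivable_tilted_sum (dXn^~ a) (dtest^~ b).
- under eq_fun do rewrite mxE.
  exact: cderivableN (cderivable_tilted_sum (dXn^~ m) (dtest^~ b)).
near=> s.
have Dort (G : {poly R[i]}) : (size G <= m.+1)%N -> pform (u s) (x ^~ s) (D s) G = 0.
  by move: G; near: s.
have nondeg (E : {poly R[i]}) : (size E <= m)%N ->
    pform (u s) (x ^~ s) E (('X - ((c s)%:C)%:P) * E) = 0 -> E = 0.
  by move: E; near: s.
have size_test j : (j < m)%N -> (size (test s j) <= m.+1)%N.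
  by move=> jm; rewrite /test size_Mmonic ?monicXn ?polyXsubC_eq0// size_XsubC size_polyXn.
have vA (r : 'rV[R[i]]_m) j :
    (r *m A s) 0 j = pform (u s) (x ^~ s) (rVpoly r) (test s j).
  rewrite mxE [rVpoly r]poly_def pform_suml.
  by apply: eq_bigr => k _; rewrite mxE pformZl insubT//= => H; congr (r _ _ * _); exact/val_inj.
split.
  (* A left kernel vector of A s is a polynomial of degree below m. *)
  apply/negP => /det0P[r r0 rA]; move: r0; apply/negP; rewrite negbK.
  apply/eqP/(can_inj rVpolyK); rewrite linear0; apply: nondeg.
    exact: size_poly.
  rewrite {2}[rVpoly r]poly_def mulr_sumr pform_sumr big1// => k _.
  by rewrite -scalerAr pformZr -vA rA mxE mulr0.
apply/rowP => j; rewrite vA mxE.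
apply/eqP; rewrite -addr_eq0 -pformDl; apply/eqP.
suff -> : rVpoly (poly_rV (D s) : 'rV_m) + 'X^m = D s by rewrite Dort// size_test.
apply/polyP => k; rewrite coefD coef_rVpoly coefXn.
case: insubP => [k' km kk'|].
  by rewrite mxE kk' ltn_eqF// addr0.
rewrite -leqNgt leq_eqVlt => /orP[/eqP<-|mk].
  by rewrite eqxx add0r; have /monicP := D_monic s; rewrite lead_coefE D_size.
by rewrite gtn_eqF// add0r nth_default// D_size.
Unshelve. all: by end_near. Qed.

(** At time s the form vanishes on D s paired with anything of degree at most
m, so its value at D t is its value at D t - D s. Both factors of the latter are
differentiable in s and vanish at s = t, hence so does the derivative. This
removes the motion of the other zeros from the computation. *)
Lemma frozen_form_is_derive0 :
  is_derive t 1 (fun s => \sum_i u s i * sqmod (D t).[cis (x i s)]) 0.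
Proof.
have size_DB s : (size (D s - D t)%R <= m)%N.
  have := @size_sub_lead _ m (D s) (D t).
  have -> : (D s)`_m = 1 by have /monicP := D_monic s; rewrite lead_coefE D_size.
  by rewrite scale1r; apply; rewrite ?D_size.
pose h i s := (D s - D t).[cis (x i s)].
have dh i : cderivable (h i) t.
  apply: (@eq_cderivable _ (fun s =>
    \sum_(k < m) ((D s)`_k - (D t)`_k) * (cis (x i s)) ^+ k)) => [s|].
    rewrite /h (horner_coef_wide _ (size_DB s)).
    by apply: eq_bigr => k _; rewrite coefB.
  apply: cderivable_sum => k; apply: cderivableM.
    apply: cderivableB (cderivable_cst _ _).
    exact: orthogonal_coef_cderivable.
  apply: (@eq_cderivable _ (fun s => ('X^k : {poly R[i]}).[cis (x i s)])) => [s|].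
    by rewrite hornerXn.
  exact: (cderivable_horner _ (cderivable_cis (@dx i))).
have ht i : h i t = 0 by rewrite /h subrr horner0.
apply: (@near_eq_is_derive _ _ _ (fun s => \sum_i u s i * sqmod (h i s))).
  near=> s.
  have Dort (G : {poly R[i]}) : (size G <= m.+1)%N ->
      pform (u s) (x ^~ s) (D s) G = 0 by move: G; near: s.
  apply: (@complexI R); rewrite -!pform_diag.
  rewrite -(scaleN1r (D t)) pformDl !pformDr !pformZl !pformZr !Dort ?D_size//.
  rewrite -(pform_conj _ _ (D s)) Dort ?D_size// conjc0.
  have -> : conjc (-1 : R[i]) = -1 by exact: rmorphN1.
  by ring.
have termE i : (fun s => u s i * sqmod (h i s)) =
    (fun s => u s i * complex.Re (h i s) * complex.Re (h i s)) +
    (fun s => u s i * complex.Im (h i s) * complex.Im (h i s)).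
  by apply/funext => s; rewrite fctE /sqmod; ring.
suff dterm i : is_derive t 1 (fun s => u s i * sqmod (h i s)) 0.
  by have := is_derive_big (index_enum I) dterm; rewrite big1.
rewrite termE; have [dRe dIm] := dh i.
have du := @derivable_tilted i.
have [hRe0 hIm0] : complex.Re (h i t) = 0 /\ complex.Im (h i t) = 0.
  by rewrite ht.
have dsq (f : R -> R) : derivable f t 1 -> f t = 0 ->
    is_derive t 1 (fun s => u s i * f s * f s) 0.
  move=> df f0; apply: (is_derive_mul0 (derivableM du df) df _ f0).
  by rewrite fctE f0 mulr0.
have := is_deriveD (dsq _ dRe hRe0) (dsq _ dIm hIm0).
by rewrite addr0.
Unshelve. all: by end_near. Qed.

End TiltedForm.

(** * The velocity of the cosine *)

Section Trigonometry.
Variable R : realType.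
Implicit Types x y b : R.

Lemma normr_sinD_natpi b (k : nat) : `|sin (b + k%:R * pi)| = `|sin b|.
Proof.
elim: k => [|k IH]; first by rewrite mul0r addr0.
by rewrite -natr1 mulrDl mul1r addrA sinDpi normrN.
Qed.

Lemma normr_sinD_intpi b (m : int) : `|sin (b + m%:~R * pi)| = `|sin b|.
Proof.
case: m => k; first exact: normr_sinD_natpi.
rewrite NegzE -[in RHS](subrK (k.+1%:R * pi) b) normr_sinD_natpi.
by rewrite rmorphN mulNr.
Qed.

Lemma sin_half_eq0 x y : sin ((y - x) / 2) = 0 -> eq_mod_2pi x y.
Proof.
move=> s0; pose a : R := (x - y) / 2.
(* The multiple of pi just below a; the remainder lies in [0, pi[. *)
pose m := Num.floor (a / pi).
have sa0 : sin a = 0.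
  by rewrite (_ : a = - ((y - x) / 2)) ?sinN ?s0 ?oppr0// /a; field.
have pi0 : (0 : R) < pi := pi_gt0 R.
have /andP[ma am] := floor_itv (a / pi).
have b_ge0 : 0 <= a - m%:~R * pi by rewrite subr_ge0 -ler_pdivlMr.
have b_ltpi : a - m%:~R * pi < pi.
  by move: am; rewrite ltr_pdivrMr// intrD mulrDl mul1r ltrBlDr addrC.
have sb0 : sin (a - m%:~R * pi) = 0.
  apply/eqP; rewrite -normr_eq0 -(normr_sinD_intpi _ m) subrK sa0.
  by rewrite normr0.
exists m; move: b_ge0; rewrite le_eqVlt => /orP[/eqP b0|b_gt0].
  by move: b0; rewrite /a => b0; lra.
suff : 0 < sin (a - m%:~R * pi) by rewrite sb0 ltxx.
by rewrite sin_gt0_pi// b_gt0 b_ltpi.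
Qed.

Lemma cos_subE x y :
  cos x - cos y = -2 * sin ((y - x) / 2) * sin ((- y - x) / 2).
Proof.
set p := (y - x) / 2; set q := (- y - x) / 2.
rewrite -[x]opprK cosN.
have -> : - x = p + q by rewrite /p /q; field.
have -> : y = p - q by rewrite /p /q; field.
by rewrite cosD cosB; ring.
Qed.

End Trigonometry.

Section Velocity.
Variables (R : realType) (I : finType).
Variables (gamma x : I -> R -> R) (n : nat).
Variables (phi : R -> R) (phi_ : nat -> R -> R) (t : R).

Lemma sqmod_deflated_cis (psi : nat -> R) (theta : R) :
  sqmod (deflated n psi).[cis theta] =
  \prod_(k <- index_iota 1 n.-1) (2 - 2 * cos (theta - psi k)).
Proof.
rewrite horner_prod (big_morph (@sqmod R) (@sqmodM R) (_ : _ = 1)); last first.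
  by rewrite /sqmod /= expr1n expr0n addr0.
by apply: eq_bigr => k _; rewrite hornerXsubC sqmod_cisB.
Qed.

Hypothesis dgamma : forall i, derivable (gamma i) t 1.
Hypothesis dx : forall i, derivable (x i) t 1.
Hypothesis dc : derivable (fun s => cos (phi s)) t 1.
Hypothesis sin_neq0 : forall i k, (1 <= k < n.-1)%N ->
  sin ((phi_ k t - x i t) / 2) != 0.
Hypothesis cos_neq : forall i, cos (x i t) != cos (phi t).

Let g i := sqmod (deflated n (phi_ ^~ t)).[cis (x i t)].

(** S_tilde is minus the logarithmic derivative in theta of
(cos theta - cos phi) |D|^2: the cotangents come from |D|^2, and sin / (cos - cos)
from the tilting factor. The term with the velocity of cos phi is kept apart, as
the unknown to be solved for. *)
Lemma is_derive_tilted_mass i : is_derive t 1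
  (fun s => tilted (gamma ^~ s) (x ^~ s) (cos (phi s)) i *
            sqmod (deflated n (phi_ ^~ t)).[cis (x i s)])
  (- 2 * (g i * (cos (x i t) - cos (phi t)) ^+ 2 *
     W_tilde n phi phi_ (gamma i) (x i) t)
   - 'D_1 (fun s => cos (phi s)) t * (gamma i t * g i)).
Proof.
pose G (theta : R) :=
  \prod_(k <- index_iota 1 n.-1) (2 - 2 * cos (theta - phi_ k t)).
have -> : (fun s => tilted (gamma ^~ s) (x ^~ s) (cos (phi s)) i *
      sqmod (deflated n (phi_ ^~ t)).[cis (x i s)]) =
    gamma i * (cos \o x i - (fun s => cos (phi s))) * (G \o x i).
  by apply/funext => s; rewrite sqmod_deflated_cis.
have gE : g i = G (x i t) by rewrite /g sqmod_deflated_cis.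
have dG : is_derive (x i t) 1 G
    (G (x i t) * \sum_(k <- index_iota 1 n.-1) - cot ((phi_ k t - x i t) / 2)).
  apply: is_derive_prod => k; rewrite mem_index_iota => kn.
  exact/is_derive_chord/sin_neq0.
have dxi := derivableP (@dx i).
have dtilt := is_deriveM (derivableP (@dgamma i))
  (is_deriveB (is_derive1_comp (is_derive_cos (x i t)) dxi) (derivableP dc)).
apply: is_derive_eq (is_deriveM dtilt (is_derive1_comp dG dxi)) _.
rewrite sumrN gE /W_tilde /s_tilde /S_tilde !derive1E.
have := cos_neq i; rewrite -subr_eq0 => cn.
have cn' : cos (phi t) - cos (x i t) != 0 by rewrite -opprB oppr_eq0.
rewrite !fctE /GRing.scale /=.
set S := \sum_(_ <- _ | _) _.
by field; rewrite cn cn'.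
Qed.

Lemma cos_velocity :
  is_derive t 1 (fun s => \sum_i tilted (gamma ^~ s) (x ^~ s) (cos (phi s)) i *
    sqmod (deflated n (phi_ ^~ t)).[cis (x i s)]) 0 ->
  'D_1 (fun s => cos (phi s)) t * (\sum_i gamma i t * g i) =
  - 2 * \sum_i g i * (cos (x i t) - cos (phi t)) ^+ 2 *
     W_tilde n phi phi_ (gamma i) (x i) t.
Proof.
move=> d0; have := is_derive_big (index_enum I) is_derive_tilted_mass.
move=> /@derive_val; rewrite (@derive_val _ _ _ _ _ _ _ d0) sumrB -!mulr_sumr.
by move/eqP; rewrite eq_sym subr_eq0 => /eqP->.
Qed.

Lemma deflated_mass_gt0 i : 0 < g i.
Proof.
rewrite lt_neqAle addr_ge0 ?sqr_ge0// andbT eq_sym /g sqmod_deflated_cis.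
rewrite prodf_seq_neq0; apply/allP => k; rewrite mem_index_iota => kn /=.
have -> : x i t - phi_ k t = - ((phi_ k t - x i t) / 2 + (phi_ k t - x i t) / 2).
  by field.
have := sin_neq0 i kn; set a := _ / 2 => sn0.
rewrite cosN cosD -!expr2 cos2sin2.
have -> : 2 - 2 * (1 - sin a ^+ 2 - sin a ^+ 2) = 4 * sin a ^+ 2 by ring.
by rewrite mulf_neq0 ?expf_neq0// pnatr_eq0.
Qed.

End Velocity.

(** * Deflation of a paraorthogonal polynomial *)

Section PairedZeros.
Variable R : realType.

Lemma sin_half_neq0 (x y : R) : ~ eq_mod_2pi x y -> sin ((y - x) / 2) != 0.
Proof. by move=> xy; apply/eqP => /sin_half_eq0. Qed.

Lemma cos_neq_mod_2pi (x y : R) :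
  ~ eq_mod_2pi x y -> ~ eq_mod_2pi x (- y) -> cos x != cos y.
Proof.
by move=> xy xNy; rewrite -subr_eq0 cos_subE !mulf_neq0 ?sin_half_neq0.
Qed.

(** Absorbing the conjugate pair into the measure turns the paraorthogonality of P
into orthogonality, for the tilted weight, of the deflated polynomial to all
polynomials of degree at most its own, including itself. *)
Lemma popuc_deflation (N : nat) (gamma omega : 'I_N.+1 -> R)
    (mu : {measure set (measurableTypeR R) -> \bar R}) n b P (psi : nat -> R) :
  (forall A, measurable A -> mu A = point_masses gamma omega A) ->
  injective (fun j => cis (omega j)) ->
  is_POPUC mu n b P -> zeros_labelled n P psi -> (1 < n)%N ->
  psi n.-1 = - psi n ->
  (forall j k, (1 <= k <= n)%N -> ~ eq_mod_2pi (omega j) (psi k)) ->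
  let u := tilted gamma omega (cos (psi n)) in
  [/\ forall j, 0 <= gamma j,
      exists j, gamma j != 0,
      forall G : {poly R[i]}, (size G <= n.-2.+1)%N ->
        pform u omega (deflated n psi) G = 0
    & forall E : {poly R[i]}, (size E <= n.-2)%N ->
        pform u omega E (('X - ((cos (psi n))%:C)%:P) * E) = 0 -> E = 0].
Proof.
move=> mu_def omega_inj [_ [Q [oQ PE]]] zP n1 psiN omega_psi u.
have gamma_ge0 := point_masses_weight_ge0 mu_def omega_inj.
have {}oQ := orthogonal_polys_pform mu_def gamma_ge0 oQ.
have n0 : (0 < n)%N := ltnW n1.
have cos_neq j : cos (omega j) != cos (psi n).
  apply: cos_neq_mod_2pi; first by apply: omega_psi; rewrite n0 leqnn.
  by rewrite -psiN; apply: omega_psi; rewrite -ltnS prednK// n1 leq_pred.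
split=> //.
- apply/existsP; rewrite -[[exists _, _]]negbK negb_exists; apply/negP.
  (* With no mass at all, the constant 1 vacuously vanishes at every mass. *)
  move=> /forallP g0; have : (1 : {poly R[i]}) = 0.
    apply: (pform_separates oQ); first by rewrite size_poly1.
    by move=> i gi; have := g0 i; rewrite gi.
  by move/eqP; rewrite oner_eq0.
- move=> G sG; apply: (@deflated_orthogonal _ _ _ _ P); last first.
    rewrite PE; apply: (paraorthogonal _ n0 oQ).
    by case: (n) n1 sG => [|[]].
  have n1n : (n.-1 < n)%N by rewrite prednK.
  have [monQ sQ _ _] := oQ n.-1 n1n.
  have [monP sP] := paraorthogonal_monic_size (conjc b) n0 monQ
    (etrans sQ (prednK n0)).
  rewrite -PE in monP sP; rewrite {1}(zeros_labelled_factor monP sP zP).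
  rewrite -psiN /deflated; case: (n) n1 => [|[|k]]// _.
  by rewrite big_nat_recr//= big_nat_recr.
- move=> E sE E0; apply: (pform_separates oQ) => [|i gi].
    by rewrite (leq_trans sE)// (leq_trans (leq_pred _))// leq_pred.
  exact: tilted_definite gamma_ge0 cos_neq E0 i gi.
Qed.

End PairedZeros.

(** * Monotonicity of the zero *)

Theorem theorem2p2 (R : realType) (J : set R) (t0 : R)
  (J_open : open J) (J_itv : is_interval J) (J_t0 : J t0)
  (N : nat) (gamma omega : 'I_N.+1 -> R -> R)
  (mu : R -> {finite_measure set (measurableTypeR R) -> \bar R})
  (mu_def : forall t, J t -> forall A, measurable A ->
    mu t A = point_masses (gamma ^~ t) (omega ^~ t) A)
  (gamma_diff : forall j t, J t -> derivable (gamma j) t 1)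
  (omega_diff : forall j t, J t -> derivable (omega j) t 1)
  (omega_distinct : forall t, J t -> injective (fun j => cis (omega j t)))
  (n : nat) (n_gt0 : (0 < n)%N)
  (mu_support : forall t, J t -> (`I_n #<= circle_support (mu t))%card)
  (b : R -> R[i]) (P : R -> {poly R[i]})
  (P_popuc : forall t, J t -> is_POPUC (mu t) n (b t) (P t))
  (zeta0 : R[i]) (P_zeta0 : root (P t0) zeta0)
  (eps delta : R) (eps_gt0 : 0 < eps) (delta_gt0 : 0 < delta)
  (I_sub_J : ball t0 eps `<=` J)
  (zeta : R -> R[i])
  (zeta_arc : forall t : R, ball t0 eps t -> circle_arc delta zeta0 (zeta t))
  (zeta_diff : forall t : R, ball t0 eps t -> cderivable zeta t)
  (zeta_t0 : zeta t0 = zeta0)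
  (P_zeta : forall t : R, ball t0 eps t -> root (P t) (zeta t))
  (phi : R -> R)
  (zeta_phi : forall t : R, ball t0 eps t -> zeta t = cis (phi t))
  (P_conj_zeta : forall t : R, ball t0 eps t -> root (P t) (conjc (zeta t)))
  (phi_range : forall t : R, ball t0 eps t -> 0 < phi t < pi)
  (phi_ : nat -> R -> R)
  (phi_zeros : forall t : R, ball t0 eps t -> zeros_labelled n (P t) (phi_ ^~ t))
  (phi_n : forall t : R, ball t0 eps t -> phi t = phi_ n t)
  (phi_n1 : forall t : R, ball t0 eps t -> phi t = - phi_ n.-1 t)
  (omega_neq_phi : forall j k (t : R), ball t0 eps t -> (1 <= k <= n)%N ->
    ~ eq_mod_2pi (omega j t) (phi_ k t)) :
  ((forall t : R, ball t0 eps t ->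
      (forall j, 0 <= W_tilde n phi phi_ (gamma j) (omega j) t) /\
      (exists j, W_tilde n phi phi_ (gamma j) (omega j) t <> 0)) ->
    moves_strictly_ccw (ball t0 eps) zeta phi) /\
  ((forall t : R, ball t0 eps t -> forall j,
      W_tilde n phi phi_ (gamma j) (omega j) t = 0) ->
    does_not_move (ball t0 eps) zeta).
Proof.
have near_ball (t : R) : ball t0 eps t -> nbhs t (ball t0 eps).
  by move=> It; apply: open_nbhs_nbhs; split => //; exact: ball_open.
have dc (t : R) : ball t0 eps t -> derivable (fun s => cos (phi s)) t 1.
  move=> It; have [dRe _] := zeta_diff t It; move: dRe.
  apply: near_eq_derivable; near=> s; rewrite zeta_phi//.
  by near: s; exact: near_ball.
(* For n = 1 the zero would be its own conjugate, whereas sin phi is positive. *)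
have n_gt1 : (1 < n)%N.
  have It : ball t0 eps t0 := ballxx t0 eps_gt0.
  rewrite ltn_neqAle n_gt0 andbT; apply/eqP => n1.
  have [_ _ roots] := phi_zeros t0 It.
  have /roots[k] := P_conj_zeta t0 It.
  rewrite -n1 -eqn_leq => /eqP <-.
  rewrite {1}n1 -phi_n// zeta_phi// conjcis => -[_ /eqP].
  rewrite sinN eq_sym -addr_eq0 -mulr2n mulrn_eq0 /=.
  by rewrite gt_eqF// sin_gt0_pi// phi_range.
have defl (t : R) : ball t0 eps t ->
    let u := tilted (gamma ^~ t) (omega ^~ t) (cos (phi t)) in
    [/\ forall j, 0 <= gamma j t,
        exists j, gamma j t != 0,
        forall G : {poly R[i]}, (size G <= n.-2.+1)%N ->
          pform u (omega ^~ t) (deflated n (phi_ ^~ t)) G = 0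
      & forall E : {poly R[i]}, (size E <= n.-2)%N ->
          pform u (omega ^~ t) E (('X - ((cos (phi t))%:C)%:P) * E) = 0 -> E = 0].
  move=> It; have Jt := I_sub_J _ It; rewrite phi_n//.
  apply: popuc_deflation (mu_def t Jt) (omega_distinct t Jt) (P_popuc t Jt)
    (phi_zeros t It) n_gt1 _ _ => [|j k kn]; last exact: omega_neq_phi.
  by rewrite -phi_n// phi_n1// opprK.
(* The factors g j absorb all the positive quantities, so that only the sign of
W_tilde matters. *)
have velocity (t : R) : ball t0 eps t -> exists2 g : 'I_N.+1 -> R, forall j, 0 < g j &
    exists2 M : R, 0 < M & 'D_1 (fun s => cos (phi s)) t * M =
      - 2 * \sum_j g j * W_tilde n phi phi_ (gamma j) (omega j) t.
  move=> It; have Jt := I_sub_J _ It.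
  have dgamma j := gamma_diff j t Jt; have domega j := omega_diff j t Jt.
  have [gamma_ge0 [j0 gj0] _ _] := defl t It.
  have sin_neq0 j k : (1 <= k < n.-1)%N -> sin ((phi_ k t - omega j t) / 2) != 0.
    move=> /andP[k1 kn]; apply/sin_half_neq0/omega_neq_phi => //.
    by rewrite k1 ltnW// (leq_trans kn)// leq_pred.
  have cos_neq j : cos (omega j t) != cos (phi t).
    apply: cos_neq_mod_2pi.
      by rewrite phi_n//; apply: omega_neq_phi; rewrite // n_gt0 leqnn.
    rewrite phi_n1// opprK; apply: omega_neq_phi => //.
    by rewrite leq_pred -ltnS prednK ?n_gt1.
  pose g j := sqmod (deflated n (phi_ ^~ t)).[cis (omega j t)].
  have g_gt0 j : 0 < g j by exact: (deflated_mass_gt0 sin_neq0).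
  exists (fun j => g j * (cos (omega j t) - cos (phi t)) ^+ 2) => [j|].
    by rewrite mulr_gt0// exprn_even_gt0//= subr_eq0.
  exists (\sum_j gamma j t * g j).
    rewrite (bigD1 j0)//=; apply: ltr_pwDl.
      by rewrite mulr_gt0// lt_neqAle eq_sym gj0 gamma_ge0.
    by apply: sumr_ge0 => j _; rewrite mulr_ge0// ltW.
  apply: cos_velocity => //; first exact: dc.
  apply: (@frozen_form_is_derive0 _ _ _ _ (fun s => cos (phi s)) _ _ _ _ n.-2
    (fun s => deflated n (phi_ ^~ s))) => //; first exact: dc.
  - by move=> s; exact: deflated_monic.
  - by move=> s; exact: size_deflated.
  - near=> s; have Is : ball t0 eps s by near: s; exact: near_ball.
    by have [] := defl s Is.
  - near=> s; have Is : ball t0 eps s by near: s; exact: near_ball.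
    by have [] := defl s Is.
have mvt (s t : R) : ball t0 eps s -> ball t0 eps t -> s < t ->
    exists2 r, ball t0 eps r & cos (phi t) - cos (phi s) =
      'D_1 (fun s => cos (phi s)) r * (t - s).
  move=> Is It st; have st_ball (r : R) : s <= r <= t -> ball t0 eps r.
    move: Is It; rewrite ball_itv /= !in_itv /= => /andP[s1 _] /andP[_ t2].
    by move=> /andP[sr rt]; rewrite (lt_le_trans s1 sr) (le_lt_trans rt t2).
  have [r||r rst ->] := @MVT _ (fun s => cos (phi s))
      ('D_1 (fun s => cos (phi s))) s t st.
  - rewrite in_itv /= => /andP[sr rt]; apply/derivableP/dc/st_ball.
    by rewrite !ltW.
  - apply: derivable_within_continuous => r; rewrite in_itv /= => rst.
    exact/dc/st_ball.
  - exists r => //; apply: st_ball; move: rst; rewrite in_itv /= => /andP[sr rt].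
    by rewrite !ltW.
have phi_in (t : R) : ball t0 eps t -> phi t \in `[0, pi]%R.
  by move=> /phi_range /andP[p0 ppi]; rewrite in_itv /= !ltW.
split=> [W_pos|W0].
- split.
    split; last exact: zeta_phi.
    apply: continuous_in_subspaceT => t; rewrite inE => It.
    apply/differentiable_continuous/derivable1_diffP.
    (* phi stays in ]0, pi[, where the arccosine recovers it from Re zeta. *)
    have acosE : {near t, acos \o (fun s => cos (phi s)) =1 phi}.
      by near=> s; rewrite /= cosK// phi_in//; near: s; exact: near_ball.
    apply: near_eq_derivable acosE _.
    have cos_itv : -1 < cos (phi t) < 1.
      have /andP[p0 ppi] := phi_range t It.
      have pi0 := pi_ge0 R.
      by rewrite -cospi -cos0 !ltr_cos ?in_itv/= ?lexx ?pi0 ?p0 ?ppi ?ltW.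
    by have [] := is_derive1_comp (is_derive1_acos cos_itv) (derivableP (dc t It)).
  move=> s t Is It st; rewrite -ltr_cos ?phi_in// -subr_lt0.
  have [r Ir ->] := mvt s t Is It st.
  rewrite nmulr_rlt0 ?subr_gt0//.
  have [g g_gt0 [M M_gt0 DM]] := velocity r Ir.
  have [W_ge0 [j0 Wj0]] := W_pos r Ir.
  rewrite -(pmulr_llt0 _ M_gt0) DM mulNr oppr_lt0 pmulr_rgt0//.
  rewrite (bigD1 j0)//=; apply: ltr_pwDl.
    by rewrite mulr_gt0// lt_neqAle W_ge0 andbT eq_sym; exact/eqP.
  by apply: sumr_ge0 => j _; rewrite mulr_ge0// ltW.
- suff cst (s t : R) : ball t0 eps s -> ball t0 eps t -> s < t -> zeta s = zeta t.
    by move=> s t Is It; case: (ltgtP s t) => [/cst->|/cst->|->].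
  move=> Is It st; rewrite !zeta_phi//; congr cis.
  apply: cos_inj; rewrite ?phi_in//; apply/eqP; rewrite eq_sym -subr_eq0.
  have [r Ir ->] := mvt s t Is It st.
  have [g g_gt0 [M M_gt0]] := velocity r Ir.
  rewrite big1 ?mulr0 => [/eqP|j _]; last by rewrite W0 ?mulr0.
  by rewrite mulf_eq0 (gt_eqF M_gt0) orbF => /eqP->; rewrite mul0r.
Unshelve. all: by end_near. Qed.
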